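(* Let $\mathcal H$ and $\mathcal G$ be real Hilbert spaces, let $A\colon\mathcal H\to 2^{\mathcal H}$ and $B\colon\mathcal G\to 2^{\mathcal G}$ be maximally monotone, and let $L\colon\mathcal H\to\mathcal G$ be a bounded linear operator. Consider the primal problem: find $x\in\mathcal H$ with $0\in Ax+L^*BLx$, and the dual problem: find $v\in\mathcal G$ with $0\in -LA^{-1}(-L^*v)+B^{-1}v$. Set $R=(\mathrm{Id}+LL^* )^{-1}$, $Q=(\mathrm{Id}+L^*L)^{-1}$, and assume $\operatorname{zer}(A+L^*BL)\neq\varnothing$. Let $(\lambda_n)$ be a sequence in $\left]0,2\right[$, $(a_n)$ a sequence in $\mathcal H$, $(b_n)$ a sequence in $\mathcal G$, with $\sum_n\lambda_n(2-\lambda_n)=+\infty$ and $\sum_n\lambda_n\sqrt{\|a_n\|^2+\|b_n\|^2}<+\infty$. Let $x_0\in\mathcal H$, $v_0\in\mathcal G$, set $y_0=Lx_0$, $u_0=-L^*v_0$, and for every $n$: $p_n=J_A(x_n+u_n)+a_n$, $q_n=J_B(y_n+v_n)+b_n$, $r_n=x_n+u_n-p_n$, $s_n=y_n+v_n-q_n$, $t_n=R(Lr_n-s_n)$, $w_n=R(Lp_n-q_n)$, $x_{n+1}=x_n+\lambda_n(L^*t_n-r_n)$, $y_{n+1}=y_n-\lambda_n(t_n+s_n)$, $u_{n+1}=u_n-\lambda_nL^*w_n$, $v_{n+1}=v_n+\lambda_nw_n$. Then, writing $\widetilde t_n=Q(r_n+L^*s_n)$ and $\widetilde w_n=Q(p_n+L^*q_n)$: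 (i) $x_n-\widetilde w_n+Q(a_n+L^*b_n)\to0$ and $y_n-L\widetilde w_n+LQ(a_n+L^*b_n)\to0$; (ii) $u_n-r_n+\widetilde t_n-a_n+Q(a_n+L^*b_n)\to0$ and $v_n-s_n+L\widetilde t_n-b_n+LQ(a_n+L^*b_n)\to0$. Moreover, there exist a solution $\overline x$ of the primal problem and a solution $\overline v$ of the dual problem such that (iii) $-L^*\overline v\in A\overline x$ and $\overline v\in BL\overline x$; (iv) $x_n\rightharpoonup\overline x$ and $v_n\rightharpoonup\overline v$.
   Context: $J_A=(\mathrm{Id}+A)^{-1}$ is the resolvent; $A^{-1}$ is the set-valued inverse; $\operatorname{zer}$ is the zero set; $\to$ is strong and $\rightharpoonup$ weak convergence. *)

(* Defs.v *)
From HB Require Import structures.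
From mathcomp Require Import all_boot all_order all_algebra.
From mathcomp Require Import all_classical all_reals all_analysis.
Set Implicit Arguments. Unset Strict Implicit. Unset Printing Implicit Defensive.
Import Order.TTheory GRing.Theory Num.Theory.
Import numFieldNormedType.Exports.
Local Open Scope classical_set_scope.
Local Open Scope ring_scope.

Section Defs.
Context {R : realType}.

(* ip is an inner product inducing the norm of V: symmetric, linear in the
   first argument, and <x,x> = ||x||^2 (hence positive definite).  A real
   Hilbert space is a completeNormedModType R with such an ip. *)
Definition inner_product_of (V : normedModType R) (ip : V -> V -> R) : Prop :=
  [/\ (forall x y, ip x y = ip y x),
      (forall (a : R) x y z, ip (a *: x + y) z = a * ip x z + ip y z) &
      (forall x, ip x x = `|x| ^+ 2)].

Definition monotone_op (V : normedModType R) (ip : V -> V -> R)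
  (A : V -> set V) : Prop :=
  forall x y u v, A x u -> A y v -> 0 <= ip (x - y) (u - v).

Definition maximally_monotone (V : normedModType R) (ip : V -> V -> R)
  (A : V -> set V) : Prop :=
  monotone_op ip A /\
  forall x u, (forall y v, A y v -> 0 <= ip (x - y) (u - v)) -> A x u.

Definition adjoint_of (U V : normedModType R) (ipU : U -> U -> R)
  (ipV : V -> V -> R) (L : U -> V) (Lt : V -> U) : Prop :=
  forall x v, ipU x (Lt v) = ipV (L x) v.

Definition op_inv (U V : Type) (A : U -> set V) : V -> set U :=
  fun y => [set x | A x y].

Definition map_inv (U V : Type) (T : U -> V) : V -> set U :=
  fun y => [set x | T x = y].

Definition op_add (U V : normedModType R) (A B : U -> set V) : U -> set V :=
  fun x => [set z | exists a b, [/\ A x a, B x b & z = a + b]].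

Definition resolvent (V : normedModType R) (A : V -> set V) : V -> set V :=
  op_inv (op_add (fun x => [set x]) A).

Definition zer (V : normedModType R) (A : V -> set V) : set V :=
  [set x | A x 0].

Definition weak_cvg (V : normedModType R) (ip : V -> V -> R)
  (x : nat -> V) (l : V) : Prop :=
  forall z, (fun n => ip (x n) z) @ \oo --> ip l z.

End Defs.

(* Main.v *)
(* In the product space with inner product <.,.>_H + <.,.>_G, let V be the graph
   of L and P the orthogonal projector onto V; the orthogonal complement of V is
   {(-L^* v, v)}, and P exists because Id + L^* L is onto.  The pairs
   xi_n = (x_n + u_n, y_n + v_n) have components (x_n, y_n) in V and (u_n, v_n)
   in its orthogonal complement, and they form an inexact relaxed proximal point
   sequence for the partial inverse N of A x B with respect to V: xi_n = g_n + d_n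
   with d_n in N g_n, and xi_{n+1} = xi_n + lambda_n (e_n - d_n) with
   |e_n| = |(a_n, b_n)|.  The distances of xi_n to the zeros of N are
   quasi-decreasing, so lambda_n (2 - lambda_n) |d_n|^2 is summable; since |d_n|
   is quasi-decreasing too, d_n -> 0, which gives (i) and (ii) after projecting.
   Maximality of N places all weak cluster points of xi_n among the zeros of N,
   and Opial's lemma yields weak convergence.  Working with the graph of N rather
   than with its resolvent avoids Minty's theorem. *)

Require Import Defs.
From HB Require Import structures.
From mathcomp Require Import all_boot all_order all_algebra.
From mathcomp Require Import all_classical all_reals all_analysis.
From mathcomp Require Import ring lra.
Import Order.TTheory GRing.Theory Num.Theory.
Import numFieldNormedType.Exports.
Local Open Scope classical_set_scope.
Local Open Scope ring_scope.

Lemma cvgn_squeeze0 {R : realType} {V : normedModType R} (f : nat -> V)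
    (g : nat -> R) :
  (forall n, `|f n| <= g n) -> g @ \oo --> 0 -> f @ \oo --> 0.
Proof.
move=> fg g0; apply/norm_cvg0P.
apply: (squeeze_cvgr (f := fun=> 0) (h := g)) => //; last exact: cvg_cst.
by apply: nearW => n; rewrite normr_ge0 fg.
Qed.

(** * Inner products on a bare vector space, up to Riesz representation *)

Section InnerProduct.
Context {R : realType} {E : lmodType R}.
Implicit Types (ip : E -> E -> R) (x y z h : E).

(** Detached from the norm of the carrier: [H * G] comes with the maximum norm, not the Euclidean
    one, and [H] later receives a second inner product. *)
Definition inner_product ip : Prop :=
  [/\ (forall x y, ip x y = ip y x),
      (forall (a : R) x y z, ip (a *: x + y) z = a * ip x z + ip y z),
      (forall x, 0 <= ip x x) &
      (forall x, ip x x = 0 -> x = 0)].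

Definition ip_norm ip x : R := Num.sqrt (ip x x).

Definition ip_complete ip : Prop :=
  forall z : nat -> E,
    (forall e : R, 0 < e -> exists N : nat, forall m n : nat,
       (N <= m)%N -> (N <= n)%N -> ip_norm ip (z m - z n) < e) ->
    exists l, (fun n => ip_norm ip (z n - l)) @ \oo --> (0 : R).

Context {ip : E -> E -> R} (ipP : inner_product ip).
Notation nrm := (ip_norm ip).

Lemma ipC x y : ip x y = ip y x. Proof. by case: ipP. Qed.

Lemma ipDl x y z : ip (x + y) z = ip x z + ip y z.
Proof. by case: ipP => _ lin _ _; rewrite -{1}[x]scale1r lin mul1r. Qed.

Lemma ip0l z : ip 0 z = 0.
Proof. by apply: (addrI (ip 0 z)); rewrite -ipDl !addr0. Qed.

Lemma ipZl a x z : ip (a *: x) z = a * ip x z.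
Proof. by case: ipP => _ lin _ _; rewrite -{1}[_ *: _]addr0 lin ip0l addr0. Qed.

Lemma ipNl x z : ip (- x) z = - ip x z.
Proof. by rewrite -scaleN1r ipZl mulN1r. Qed.

Lemma ipDr x y z : ip z (x + y) = ip z x + ip z y.
Proof. by rewrite ipC ipDl !(ipC z). Qed.

Lemma ipZr a x z : ip z (a *: x) = a * ip z x.
Proof. by rewrite ipC ipZl (ipC z). Qed.

Lemma ipNr x z : ip z (- x) = - ip z x.
Proof. by rewrite ipC ipNl (ipC z). Qed.

Lemma ip0r z : ip z 0 = 0. Proof. by rewrite ipC ip0l. Qed.

Definition ipE := (ipDl, ipDr, ipZl, ipZr, ipNl, ipNr, ip0l, ip0r).

Lemma ip_ge0 x : 0 <= ip x x. Proof. by case: ipP. Qed.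

Lemma ip_eq0 x : ip x x = 0 -> x = 0. Proof. by case: ipP => _ _ _; exact. Qed.

Lemma ip_inj x y : (forall h, ip x h = ip y h) -> x = y.
Proof.
move=> xy; apply: subr0_eq; apply: ip_eq0.
by rewrite ipDl ipNl xy subrr.
Qed.

Lemma nrm_ge0 x : 0 <= nrm x. Proof. exact: sqrtr_ge0. Qed.

Lemma sqr_nrm x : nrm x ^+ 2 = ip x x.
Proof. by rewrite sqr_sqrtr// ip_ge0. Qed.

Lemma nrmN x : nrm (- x) = nrm x.
Proof. by rewrite /ip_norm ipNl ipNr opprK. Qed.

Lemma nrmZ a x : nrm (a *: x) = `|a| * nrm x.
Proof.
by rewrite /ip_norm ipZl ipZr mulrA -expr2 sqrtrM ?sqr_ge0// sqrtr_sqr.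
Qed.

Lemma cauchy_schwarz_sq x y : ip x y ^+ 2 <= ip x x * ip y y.
Proof.
have [y0|y0] := eqVneq (ip y y) 0.
  by rewrite (ip_eq0 _ y0) ipC !ip0l expr0n mulr0.
have yp : 0 < ip y y by rewrite lt_neqAle eq_sym y0 ip_ge0.
have := ip_ge0 (ip y y *: x - ip x y *: y).
rewrite !ipE (ipC y x) => h.
rewrite -subr_ge0 -(pmulr_rge0 _ yp).
by apply: le_trans h _; rewrite le_eqVlt; apply/orP; left; apply/eqP; ring.
Qed.

Lemma cauchy_schwarz x y : `|ip x y| <= nrm x * nrm y.
Proof.
rewrite -(@ler_pXn2r _ 2)// ?nnegrE// ?mulr_ge0 ?nrm_ge0//.
by rewrite exprMn !sqr_nrm real_normK ?num_real// cauchy_schwarz_sq.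
Qed.

Lemma nrmD x y : nrm (x + y) <= nrm x + nrm y.
Proof.
rewrite -(@ler_pXn2r _ 2)// ?nnegrE ?addr_ge0 ?nrm_ge0//.
rewrite sqrrD !sqr_nrm !ipE (ipC y x).
have := le_trans (ler_norm _) (cauchy_schwarz x y); lra.
Qed.

Lemma nrmB x y : nrm (x - y) <= nrm x + nrm y.
Proof. by rewrite -(nrmN y) nrmD. Qed.

Lemma cvg_ip {z : nat -> E} {l h} :
  (fun n => nrm (z n - l)) @ \oo --> (0 : R) ->
  (fun n => ip (z n) h) @ \oo --> ip l h.
Proof.
move=> zl; apply/subr_cvg0.
apply: (cvgn_squeeze0 _ (fun n => nrm (z n - l) * nrm h)) => [n|].
  by rewrite -ipNl -ipDl cauchy_schwarz.
by rewrite -(mul0r (nrm h)); apply: cvgM => //; exact: cvg_cst.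
Qed.

(** First-order optimality: at [t = - (D / (S + 1))] the quadratic equals
    [- D ^+ 2 * (S + 2) / (S + 1) ^+ 2]; the [+ 1] covers [S = 0]. *)
Lemma quadratic_ge0 (D S : R) : 0 <= S ->
  (forall t, 0 <= 2 * t * D + t ^+ 2 * S) -> D = 0.
Proof.
move=> S0 /(_ (- (D / (S + 1)))) h.
have Sp : 0 < S + 1 by lra.
have S1 : S + 1 != 0 by rewrite gt_eqF.
have : 0 <= (2 * - (D / (S + 1)) * D + (- (D / (S + 1))) ^+ 2 * S)
    * (S + 1) ^+ 2.
  by rewrite mulr_ge0// sqr_ge0.
rewrite (_ : _ * (S + 1) ^+ 2 = - (D ^+ 2 * (S + 2))); last by field.
rewrite oppr_ge0 => h'.
apply/eqP; rewrite -sqrf_eq0 eq_le sqr_ge0 andbT.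
by rewrite -(pmulr_lle0 _ (_ : 0 < S + 2))//; lra.
Qed.

(* The representing vector minimizes [|z|^2 - 2 f z]; the parallelogram
   identity makes minimizing sequences Cauchy. *)
Lemma riesz (f : E -> R) (C : R) : ip_complete ip ->
  (forall a x y, f (a *: x + y) = a * f x + f y) -> 0 <= C ->
  (forall x, f x ^+ 2 <= C * ip x x) ->
  exists z, forall h, ip z h = f h.
Proof.
move=> cE flin C0 fC.
pose F z := ip z z - 2 * f z.
have f0 : f 0 = 0.
  by have := flin (-1) 0 0; rewrite scaler0 addr0 mulN1r addNr.
have fZ a x : f (a *: x) = a * f x.
  by rewrite -[_ *: _]addr0 flin f0 addr0.
(* Otherwise [2 * f z] exceeds [ip z z + C]; squaring and bounding [f] would give
   [(ip z z - C) ^+ 2 < 0]. *)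
have Flb z : - C <= F z.
  rewrite /F leNgt; apply/negP => h.
  have h1 := fC z; have h2 := ip_ge0 z.
  have : (ip z z + C) ^+ 2 < (2 * f z) ^+ 2.
    by rewrite ltr_pXn2r// ?nnegrE; lra.
  have := sqr_ge0 (ip z z - C).
  rewrite sqrrB sqrrD exprMn; lra.
have hinf : has_inf (range F).
  split; first by exists (F 0), 0.
  by exists (- C) => _ [z _ <-].
set m := inf (range F).
have mF z : m <= F z by apply: (ge_inf hinf.2); exists z.
have /choice [z zP] : forall n : nat, exists z, F z < m + n.+1%:R^-1.
  move=> n; have n0 : (0 : R) < n.+1%:R^-1 by rewrite invr_gt0.
  by have [_ [z _ <-] h] := inf_adherent n0 hinf; exists z.
have par : forall x y, ip (x - y) (x - y) =
    2 * F x + 2 * F y - 4 * F (2^-1 *: (x + y)).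
  move=> x y; rewrite /F fZ -[x in f (x + y)]scale1r flin !ipE (ipC y x); lra.
have n0 : (fun n : nat => n.+1%:R^-1 : R) @ \oo --> (0 : R).
  exact: cvg_harmonic.
have [|l lP] := cE z.
  move=> e e0.
  have : \forall n \near \oo, (n.+1%:R^-1 : R) < e ^+ 2 / 4.
    by apply: (cvgr_lt _ n0); rewrite divr_gt0// exprn_gt0.
  case=> N _ NP; exists N => i j Ni Nj.
  rewrite -(@ltr_pXn2r _ 2)// ?nnegrE ?nrm_ge0 ?(ltW e0)//.
  rewrite sqr_nrm par.
  have := mF (2^-1 *: (z i + z j)); have := zP i; have := zP j.
  have /= := NP i Ni; have /= := NP j Nj.
  move: (i.+1%:R^-1) (j.+1%:R^-1) (e ^+ 2) => ? ? ?; lra.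
exists l => h; apply/eqP; rewrite -subr_eq0; apply/eqP.
apply: (@quadratic_ge0 _ (ip h h)) => [|t]; first exact: ip_ge0.
have step n : - n.+1%:R^-1 <= 2 * t * (ip (z n) h - f h) + t ^+ 2 * ip h h.
  have := mF (t *: h + z n); have := zP n.
  rewrite /F flin !ipE (ipC h (z n)); move: (n.+1%:R^-1) => ?; lra.
have c1 : (fun n => 2 * t * (ip (z n) h - f h) + t ^+ 2 * ip h h) @ \oo -->
   2 * t * (ip l h - f h) + t ^+ 2 * ip h h.
  apply: cvgD; last exact: cvg_cst.
  apply: cvgM; first exact: cvg_cst.
  by apply: cvgB; [exact: cvg_ip | exact: cvg_cst].
have c2 : (fun n : nat => - n.+1%:R^-1 : R) @ \oo --> (0 : R).
  by rewrite -oppr0; exact: cvgN.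
rewrite -(cvg_lim (@norm_hausdorff _ _) c1) -(cvg_lim (@norm_hausdorff _ _) c2).
apply: ler_lim; last exact: nearW.
  by apply/cvg_ex; eexists; exact: c2.
by apply/cvg_ex; eexists; exact: c1.
Qed.

End InnerProduct.

(* Pairing both sides with an arbitrary vector turns a linear identity in [E]
   into a scalar one. *)
Ltac lmod_ring ipP := apply: (ip_inj ipP) => ?; rewrite !(ipE ipP); ring.



(** * Ultrafilter limits and quasi-decreasing real sequences *)

Lemma fmap_ultra {T X : Type} (f : T -> X) (U : set_system T) :
  UltraFilter U -> UltraFilter (f @ U).
Proof.
move=> UU; have UP := @ultra_proper _ _ UU.
split=> [|F FP FU]; first exact: fmap_proper_filter.
apply/seteqP; split=> // B FB.
have [//|UnB] := in_ultra_setVsetC (f @^-1` B) UU.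
have FnB : F (~` B) by apply: FU.
have : F set0 by rewrite -(setICr B); exact: filterI.
by move/filter_not_empty.
Qed.

Section RealSequences.
Context {R : realType}.

Lemma bounded_ultra_cvg (U : set_system nat) (f : nat -> R) (C : R) :
  UltraFilter U -> (forall n, `|f n| <= C) -> exists l : R, f @ U --> l.
Proof.
move=> UU fC.
have := @segment_compact R (- C) C; rewrite compact_ultra => /(_ (f @ U)).
case=> [||l [_ fl]]; [exact: fmap_ultra| |by exists l].
have UP := @ultra_proper _ _ UU.
apply: (@filterE _ U) => n; by rewrite /= in_itv/= -ler_norml.
Qed.

(** If a neighbourhood [A] of [l] is missed infinitely often, [\oo] restricted to the missing
    indices is still proper, and an ultrafilter refining it contradicts the hypothesis. *)
Lemma cvg_ultra (f : nat -> R) (l : R) :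
  (forall U : set_system nat, UltraFilter U -> \oo `<=` U -> f @ U --> l) ->
  f @ \oo --> l.
Proof.
move=> fU A Al; apply: contrapT => nA.
pose F := within (~` (f @^-1` A)) (\oo : set_system nat).
have FF : ProperFilter F.
  apply: Build_ProperFilter => F0; apply: nA.
  rewrite /F /within /= in F0.
  by apply: (@filterS _ \oo _ _ (f @^-1` A) _ F0) => n h; apply: contrapT => /h.
have [U [UU FU]] := ultraFilterLemma FF.
have UP := @ultra_proper _ _ UU.
have Uinf : \oo `<=` U.
  by move=> B Binf; apply: FU; apply: filterS Binf => n.
have UnA : U (~` (f @^-1` A)) by apply: FU; exact: nearW.
have UA : U (f @^-1` A) by exact: fU UU Uinf A Al.
have : U (~` (f @^-1` A) `&` f @^-1` A) by exact: filterI.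
by rewrite setICl => /filter_not_empty.
Qed.

(** Subtracting the partial sums of [ep] from [al] leaves a nonincreasing sequence bounded below by
    [- S]. *)
Lemma quasi_fejer (al ep : nat -> R) (S : R) :
  (forall n, 0 <= al n) -> (forall n, 0 <= ep n) ->
  (forall n, al n.+1 <= al n + ep n) ->
  (forall n, \sum_(0 <= k < n) ep k <= S) ->
  (forall n, al n <= al 0%N + S) /\ cvgn al.
Proof.
move=> al0 ep0 step epS.
pose sg n := \sum_(0 <= k < n) ep k.
have sgS n : sg n.+1 = sg n + ep n by rewrite /sg big_nat_recr.
have dec : {homo (fun n => al n - sg n) : n m / (n <= m)%N >-> m <= n}.
  apply/nonincreasing_seqP => n; rewrite sgS; have := step n; lra.
split=> [n|].
  have := dec 0%N n (leq0n _); have := epS n.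
  by rewrite /= /sg [\sum_(0 <= k < 0) _]big_geq//; lra.
have -> : al = (fun n => al n - sg n) \+ sg.
  by apply/funext => n /=; rewrite subrK.
apply: is_cvgD.
  apply: nonincreasing_is_cvgn => //.
  by exists (- S) => _ [n _ <-]; have := epS n; have := al0 n; rewrite /sg; lra.
apply: nondecreasing_is_cvgn.
  by apply/nondecreasing_seqP => n; rewrite sgS lerDl.
by exists S => _ [n _ <-]; exact: epS.
Qed.

End RealSequences.

(** * Weak cluster points and Opial's lemma *)

Section WeakConvergence.
Context {R : realType} {E : lmodType R}.
Context {ip : E -> E -> R} (ipP : inner_product ip) (ipc : ip_complete ip).
Notation nrm := (ip_norm ip).

(** The limits of [ip (xi n) h] along [U] are linear in [h] and bounded by [C * nrm h], so Riesz
    representation applies to them. *)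
Lemma bounded_weak_ultra (U : set_system nat) (xi : nat -> E) (C : R) :
  UltraFilter U -> (forall n, nrm (xi n) <= C) ->
  exists z, forall h, (fun n => ip (xi n) h) @ U --> ip z h.
Proof.
move=> UU xiC; have UP := @ultra_proper _ _ UU.
have C0 : 0 <= C by apply: le_trans (xiC 0%N); exact: nrm_ge0.
have ipC' h n : `|ip (xi n) h| <= C * nrm h.
  apply: le_trans (cauchy_schwarz ipP _ _) _.
  by rewrite ler_wpM2r ?nrm_ge0.
have /choice [f fP] : forall h, exists l : R, (fun n => ip (xi n) h) @ U --> l.
  by move=> h; exact: bounded_ultra_cvg (ipC' h).
suff [z zP] : exists z, forall h, ip z h = f h.
  by exists z => h; rewrite zP.
apply: (riesz ipP f (C ^+ 2) ipc) => [a h k||h].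
- apply: (cvg_unique (@norm_hausdorff _ _) (fP (a *: h + k))).
  have -> : (fun n => ip (xi n) (a *: h + k)) =
      (fun n => a * ip (xi n) h + ip (xi n) k).
    by apply/funext => n; rewrite !(ipE ipP).
  apply: cvgD => //; apply: cvgM => //; exact: cvg_cst.
- exact: sqr_ge0.
- rewrite -(sqr_nrm ipP) -exprMn -(real_normK (num_real _)).
  rewrite ler_pXn2r// ?nnegrE ?mulr_ge0 ?nrm_ge0//.
  rewrite -(cvg_lim (@norm_hausdorff _ _) (cvg_norm (fP h))).
  apply: limr_le; last exact: nearW.
  by apply/cvg_ex; eexists; exact: cvg_norm (fP h).
Qed.

(* Opial's lemma, with cluster points taken along ultrafilters rather than
   subsequences. *)
Lemma opial (xi : nat -> E) (C : R) (S : set E) :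
  (forall n, nrm (xi n) <= C) ->
  (forall z, S z -> cvgn (fun n => nrm (xi n - z))) ->
  (forall (U : set_system nat) z, UltraFilter U -> \oo `<=` U ->
     (forall h, (fun n => ip (xi n) h) @ U --> ip z h) -> S z) ->
  exists z, S z /\ forall h, (fun n => ip (xi n) h) @ \oo --> ip z h.
Proof.
move=> xiC xicvg clu.
have [U0 [UU0 U0inf]] := @ultraFilterLemma _ (\oo : set_system nat) _.
have [z zP] := bounded_weak_ultra _ _ _ UU0 xiC.
have Sz := clu _ _ UU0 U0inf zP.
exists z; split=> // h; apply: cvg_ultra => U UU Uinf.
have [z' z'P] := bounded_weak_ultra _ _ _ UU xiC.
have Sz' := clu _ _ UU Uinf z'P.
suff -> : z = z' by exact: z'P.
have UP0 := @ultra_proper _ _ UU0; have UP := @ultra_proper _ _ UU.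
(* Polarization expresses [ip (xi n) (z - z')] through the distances to [z] and [z'], which converge
   along [\oo]; both ultrafilters therefore see the same limit [m]. *)
have [m mP] : exists m : R, (fun n => ip (xi n) (z - z')) @ \oo --> m.
  have /cvg_ex [l lP] := xicvg _ Sz; have /cvg_ex [l' lP'] := xicvg _ Sz'.
  exists (2^-1 * (l' ^+ 2 - l ^+ 2 + (ip z z - ip z' z'))).
  have -> : (fun n => ip (xi n) (z - z')) =
      (fun n => 2^-1 * (nrm (xi n - z') ^+ 2 - nrm (xi n - z) ^+ 2
                        + (ip z z - ip z' z'))).
    apply/funext => n; rewrite !(sqr_nrm ipP) !(ipE ipP).
    rewrite (ipC ipP z') (ipC ipP z); lra.
  apply: cvgM; first exact: cvg_cst.
  apply: cvgD; last exact: cvg_cst.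
  by apply: cvgB; rewrite [X in _ --> X]expr2; apply: cvgM.
have e1 : ip z (z - z') = m.
  apply: (cvg_unique (@norm_hausdorff _ _) (zP _)).
  exact: cvg_trans (cvg_app _ U0inf) mP.
have e2 : ip z' (z - z') = m.
  apply: (cvg_unique (@norm_hausdorff _ _) (z'P _)).
  exact: cvg_trans (cvg_app _ Uinf) mP.
apply: subr0_eq; apply: (ip_eq0 ipP).
by rewrite (ipDl ipP) (ipNl ipP) e1 e2 subrr.
Qed.

End WeakConvergence.



(** * The inexact relaxed proximal point iteration *)

Section ProximalPoint.
Context {R : realType} {E : lmodType R}.
Context {ip : E -> E -> R} (ipP : inner_product ip) (ipc : ip_complete ip).
Notation nrm := (ip_norm ip).

Definition ip_monotone (N : E -> set E) : Prop :=
  forall g g' d d', N g d -> N g' d' -> 0 <= ip (g - g') (d - d').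

Definition ip_maximal (N : E -> set E) : Prop :=
  forall g d, (forall g' d', N g' d' -> 0 <= ip (g - g') (d - d')) -> N g d.

Context (N : E -> set E) (Nmono : ip_monotone N) (Nmax : ip_maximal N).
Context (lam : nat -> R) (xi g d e : nat -> E).
Context (hlam : forall n, 0 < lam n < 2).
Context (hsum1 : forall M : R,
  exists n, M < \sum_(0 <= k < n) (lam k * (2 - lam k))).
Context (S : R) (hsum2 : forall n, \sum_(0 <= k < n) (lam k * nrm (e k)) <= S).
Context (hN : forall n, N (g n) (d n)) (hxi : forall n, xi n = g n + d n).
Context (hstep : forall n, xi n.+1 = xi n + lam n *: (e n - d n)).

Let lam_ge0 n : 0 <= lam n. Proof. by have /andP[/ltW] := hlam n. Qed.

Let err_ge0 n : 0 <= lam n * nrm (e n).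
Proof. by rewrite mulr_ge0 ?nrm_ge0. Qed.

Let err_le n : lam n * nrm (e n) <= S.
Proof.
have := hsum2 n.+1; rewrite big_nat_recr//=; apply: le_trans.
by rewrite lerDr sumr_ge0.
Qed.

(** Monotonicity between [(g n, d n)] and [(z, 0)] gives [nrm (d n) ^+ 2 <= ip (xi n - z) (d n)];
    expanding the square then produces the factor [lam n * (2 - lam n)]. *)
Lemma prox_exact_step z n : N z 0 ->
  nrm (xi n - lam n *: d n - z) ^+ 2 <=
  nrm (xi n - z) ^+ 2 - lam n * (2 - lam n) * nrm (d n) ^+ 2.
Proof.
move=> Nz; have := Nmono _ _ _ _ (hN n) Nz; rewrite subr0 => h.
have : 0 <= lam n * ip (g n - z) (d n) by rewrite mulr_ge0.
rewrite !(sqr_nrm ipP) hxi !(ipE ipP).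
rewrite (ipC ipP (d n) (g n)) (ipC ipP (d n) z) (ipC ipP z (g n)).
lra.
Qed.

Lemma prox_fejer z n : N z 0 ->
  nrm (xi n.+1 - z) <= nrm (xi n - z) + lam n * nrm (e n).
Proof.
move=> Nz.
have -> : xi n.+1 - z = (xi n - lam n *: d n - z) + lam n *: e n.
  by rewrite hstep; lmod_ring ipP.
apply: le_trans (nrmD ipP _ _) _; rewrite (nrmZ ipP) ger0_norm// lerD2r.
rewrite -(@ler_pXn2r _ 2)// ?nnegrE ?nrm_ge0//.
apply: le_trans (prox_exact_step _ n Nz) _.
rewrite gerBl mulr_ge0 ?sqr_ge0// mulr_ge0//.
by have /andP[_ /ltW] := hlam n; rewrite subr_ge0.
Qed.

Lemma prox_dist_cvg z : N z 0 ->
  (forall n, nrm (xi n - z) <= nrm (xi 0%N - z) + S) /\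
  cvgn (fun n => nrm (xi n - z)).
Proof.
move=> Nz; apply: (quasi_fejer (fun n => nrm (xi n - z))
  (fun n => lam n * nrm (e n))) => // n; first exact: nrm_ge0.
exact: prox_fejer.
Qed.

(* With [D = d n - d n.+1], monotonicity of [N] says that [D] lies in the ball
   with diameter [[0, lam n *: (d n - e n)]]; no resolvent at the intermediate
   point [xi n - lam n *: d n] is needed. *)
Lemma prox_residual_step n : nrm (d n.+1) <= nrm (d n) + lam n * nrm (e n).
Proof.
pose f := d n - e n; pose D := d n - d n.+1.
have ball : nrm (D - (lam n / 2) *: f) <= lam n / 2 * nrm f.
  have h : ip D D <= lam n * ip D f.
    have := Nmono _ _ _ _ (hN n) (hN n.+1).
    have -> : g n - g n.+1 = lam n *: f - D.
      have := hstep n; rewrite hxi hxi => /(canRL (addrK _)) ->.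
      by rewrite /D /f; lmod_ring ipP.
    by rewrite -/D (ipDl ipP) (ipZl ipP) (ipNl ipP) (ipC ipP f) subr_ge0.
  rewrite -(@ler_pXn2r _ 2)// ?nnegrE ?mulr_ge0 ?nrm_ge0//.
  clearbody D f; rewrite exprMn !(sqr_nrm ipP) !(ipE ipP) (ipC ipP f D); lra.
(* Here [ball] bounds the last term by [lam n / 2 * nrm f], and [nrm f <= nrm (d n) + nrm (e n)], so
   the coefficients of [nrm (d n)] add up to 1. *)
have -> : d n.+1 = (1 - lam n / 2) *: d n + ((lam n / 2) *: e n
    - (D - (lam n / 2) *: f)).
  by rewrite /D /f; lmod_ring ipP.
have l2 : 0 <= 1 - lam n / 2 by have /andP[_ ?] := hlam n; lra.
have l0 : 0 <= lam n / 2 by rewrite mulr_ge0.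
apply: le_trans (nrmD ipP _ _) _; rewrite (nrmZ ipP) ger0_norm//.
have := nrmB ipP ((lam n / 2) *: e n) (D - (lam n / 2) *: f).
rewrite (nrmZ ipP) (ger0_norm l0).
have : lam n / 2 * nrm f <= lam n / 2 * (nrm (d n) + nrm (e n)).
  by rewrite ler_wpM2l// nrmB.
lra.
Qed.

Lemma prox_energy z : N z 0 -> exists K, forall n,
  \sum_(0 <= k < n) (lam k * (2 - lam k) * nrm (d k) ^+ 2) <= K.
Proof.
move=> Nz; have [bnd _] := prox_dist_cvg _ Nz.
(* [C] bounds all distances to [z]. With [w = lam n * nrm (e n)], the error adds at most
   [2 * C * w + w ^+ 2] to the squared distance, and [w <= S]; hence [K]. *)
pose C := nrm (xi 0%N - z) + S; pose K := 2 * C + S.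
have S0 : 0 <= S := le_trans (err_ge0 0%N) (err_le 0%N).
have K0 : 0 <= K by rewrite /K /C; have := @nrm_ge0 _ _ ip (xi 0%N - z); lra.
have step n : nrm (xi n.+1 - z) ^+ 2 <= nrm (xi n - z) ^+ 2
    - lam n * (2 - lam n) * nrm (d n) ^+ 2 + K * (lam n * nrm (e n)).
  have := prox_exact_step _ n Nz.
  set eta := xi n - lam n *: d n - z => eta2.
  have eta_le : nrm eta <= C.
    apply: le_trans (bnd n); rewrite -(@ler_pXn2r _ 2)// ?nnegrE ?nrm_ge0//.
    apply: le_trans eta2 _; rewrite gerBl mulr_ge0 ?sqr_ge0// mulr_ge0//.
    by have /andP[_ /ltW] := hlam n; rewrite subr_ge0.
  have -> : xi n.+1 - z = eta + lam n *: e n.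
    by rewrite hstep /eta; lmod_ring ipP.
  have tri : nrm (eta + lam n *: e n) ^+ 2 <=
      (nrm eta + lam n * nrm (e n)) ^+ 2.
    rewrite ler_pXn2r// ?nnegrE ?addr_ge0 ?nrm_ge0//.
    by rewrite -[lam n in X in _ <= X]ger0_norm// -(nrmZ ipP) nrmD.
  move: tri (err_le n) (err_ge0 n); set w := lam n * nrm (e n) => tri wS w0.
  have h1 : nrm eta * w <= C * w by rewrite ler_wpM2r.
  have h2 : w * w <= S * w by rewrite ler_wpM2r.
  move: tri; rewrite sqrrD /K; lra.
exists (nrm (xi 0%N - z) ^+ 2 + K * S) => n.
suff : nrm (xi n - z) ^+ 2 +
    \sum_(0 <= k < n) (lam k * (2 - lam k) * nrm (d k) ^+ 2) <=
    nrm (xi 0%N - z) ^+ 2 + K * \sum_(0 <= k < n) (lam k * nrm (e k)).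
  have := ler_wpM2l K0 (hsum2 n); have := sqr_ge0 (nrm (xi n - z)); lra.
elim: n => [|n IH]; first by rewrite !big_geq// mulr0.
by rewrite !big_nat_recr//=; have := step n; lra.
Qed.

(** The quasi-decreasing [nrm (d n)] has a limit [l]. If [l] were positive, the weights
    [lam n * (2 - lam n)] would eventually be dominated by a multiple of the summable energy,
    against their divergence. *)
Lemma prox_residual_cvg z : N z 0 -> (fun n => nrm (d n)) @ \oo --> (0 : R).
Proof.
move=> Nz; have [K KP] := prox_energy _ Nz.
have d0 n : 0 <= nrm (d n) by exact: nrm_ge0.
have [_ /cvg_ex[/= l dl]] := quasi_fejer (fun n => nrm (d n))
  (fun n => lam n * nrm (e n)) S d0 err_ge0 prox_residual_step hsum2.
have l0 : 0 <= l.
  rewrite -(cvg_lim (@norm_hausdorff _ _) dl).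
  by apply: limr_ge; [apply/cvg_ex; exists l | exact: nearW].
have [<-//|l1] := eqVneq l 0.
have lp : 0 < l by rewrite lt_neqAle eq_sym l1.
have l2 : l / 2 < l by lra.
have [M _ MP] := cvgr_ge _ dl _ l2.
have wd n : (M <= n)%N -> lam n * (2 - lam n) <=
    4 / l ^+ 2 * (lam n * (2 - lam n) * nrm (d n) ^+ 2).
  move=> /MP /= h; have := hlam n => /andP[p1 p2].
  rewrite mulrCA -[leLHS]mulr1 ler_wpM2l ?mulr_ge0//; first lra.
  rewrite mulrC mulrA ler_pdivlMr ?exprn_gt0// mul1r.
  have : (l / 2) ^+ 2 <= nrm (d n) ^+ 2 by rewrite ler_pXn2r// nnegrE; lra.
  by rewrite expr_div_n; lra.
have [n nP] := hsum1 (4 / l ^+ 2 * K + M%:R).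
(* Indices below [M], where [l / 2] need not bound [nrm (d k)] from below, cost at most 1 each since
   [lam k * (2 - lam k) <= 1]; [minn n M] counts them. *)
suff : \sum_(0 <= k < n) (lam k * (2 - lam k)) <=
    4 / l ^+ 2 * \sum_(0 <= k < n) (lam k * (2 - lam k) * nrm (d k) ^+ 2)
    + (minn n M)%:R.
  have : (minn n M)%:R <= M%:R :> R by rewrite ler_nat geq_minr.
  have c0 : 0 <= 4 / l ^+ 2 by rewrite divr_ge0// exprn_ge0.
  have := ler_wpM2l c0 (KP n); lra.
elim: {nP} n => [|n IH]; first by rewrite !big_geq// min0n mulr0 addr0.
rewrite !big_nat_recr//= mulrDr; have [Mn|nM] := leqP M n.
  by move: IH; rewrite !(minn_idPr _)// 1?ltnW//; have := wd _ Mn; lra.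
move: IH; rewrite (minn_idPl (ltnW nM)) (minn_idPl nM) -[n.+1%:R]natr1.
have c1 : 0 <= 4 / l ^+ 2 * (lam n * (2 - lam n) * nrm (d n) ^+ 2).
  have /andP[? ?] := hlam n.
  by rewrite !mulr_ge0 ?invr_ge0 ?exprn_ge0//; lra.
have : lam n * (2 - lam n) <= 1 by have := sqr_ge0 (lam n - 1); lra.
lra.
Qed.

(** Opial's lemma reduces this to cluster points: along an ultrafilter [g n = xi n - d n] tends
    weakly to [z] and [d n] strongly to 0, so monotonicity against any [(g', d')] passes to the
    limit, and maximality gives [N z 0]. *)
Lemma prox_weak_cvg : (exists z, N z 0) ->
  exists z, N z 0 /\ forall h, (fun n => ip (xi n) h) @ \oo --> ip z h.
Proof.
case=> z0 Nz0; have [bnd _] := prox_dist_cvg _ Nz0.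
have dcv := prox_residual_cvg _ Nz0.
pose C := nrm (xi 0%N - z0) + S + nrm z0.
have xiC n : nrm (xi n) <= C.
  rewrite -[xi n](subrK z0); apply: le_trans (nrmD ipP _ _) _.
  by rewrite lerD2r.
apply: (opial ipP ipc xi C (fun z => N z 0)) => // [z Nz|U z UU Uinf zP].
  by have [] := prox_dist_cvg _ Nz.
have UP := @ultra_proper _ _ UU.
apply: Nmax => g' d' Ngd.
have dU : (fun n => nrm (d n)) @ U --> (0 : R).
  exact: cvg_trans (cvg_app _ Uinf) dcv.
have ipd h : (fun n => ip (d n) h) @ U --> (0 : R).
  rewrite -(ip0l ipP h).
  apply: cvg_trans (cvg_app _ Uinf) _; apply: (cvg_ip ipP).
  by under eq_fun do rewrite subr0.
have c1 : (fun n => ip (xi n - g') (d n)) @ \oo --> (0 : R).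
  apply: (cvgn_squeeze0 _ (fun n => (C + nrm g') * nrm (d n))) => [n|].
    apply: le_trans (cauchy_schwarz ipP _ _) _; rewrite ler_wpM2r ?nrm_ge0//.
    by apply: le_trans (nrmB ipP _ _) _; rewrite lerD2r.
  by rewrite -(mulr0 (C + nrm g')); apply: cvgM => //; exact: cvg_cst.
have lim : (fun n => ip (g n - g') (d n - d')) @ U --> ip (z - g') (0 - d').
  have -> : (fun n => ip (g n - g') (d n - d')) = (fun n =>
      ip (xi n - g') (d n) - nrm (d n) * nrm (d n) + ip (d n) d'
      + (ip g' d' - ip (xi n) d')).
    apply/funext => n; rewrite -expr2 (sqr_nrm ipP) hxi !(ipE ipP); ring.
  have -> : ip (z - g') (0 - d') = 0 - 0 * 0 + 0 + (ip g' d' - ip z d').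
    by rewrite !(ipE ipP); ring.
  apply: cvgD; [apply: cvgD; [apply: cvgB|]|] => //.
  - exact: cvg_trans (cvg_app _ Uinf) c1.
  - exact: cvgM.
  - by apply: cvgB => //; exact: cvg_cst.
rewrite -(cvg_lim (@norm_hausdorff _ _) lim).
apply: limr_ge; first by apply/cvg_ex; eexists; exact: lim.
by apply: nearW => n; exact: Nmono.
Qed.

End ProximalPoint.
Arguments ip_monotone {R E} ip N.
Arguments ip_maximal {R E} ip N.



(** * Partial inverses with respect to the range of an orthogonal projector *)

Section PartialInverse.
Context {R : realType} {E : lmodType R}.
Context {ip : E -> E -> R} (ipP : inner_product ip) (ipc : ip_complete ip).
Notation nrm := (ip_norm ip).
Context (P : E -> E) (Plin : forall a x y, P (a *: x + y) = a *: P x + P y).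
Context (Pid : forall x, P (P x) = P x).
Context (Psym : forall x y, ip (P x) y = ip x (P y)).

Let PB x y : P (x - y) = P x - P y.
Proof. by rewrite addrC -scaleN1r Plin scaleN1r addrC. Qed.

Let P0 : P 0 = 0. Proof. by have := PB 0 0; rewrite !subrr. Qed.

Let PN x : P (- x) = - P x.
Proof. by have := PB 0 x; rewrite P0 !sub0r. Qed.

Let PD x y : P (x + y) = P x + P y.
Proof. by rewrite -{1}[x]scale1r Plin scale1r. Qed.

Let PP x y : ip (P x) (P y) = ip (P x) y. Proof. by rewrite -Psym Pid. Qed.

Lemma nrm_projector_le x : nrm (P x) <= nrm x.
Proof.
have [->|Px0] := eqVneq (nrm (P x)) 0; first exact: nrm_ge0.
have Pxp : 0 < nrm (P x) by rewrite lt_neqAle eq_sym Px0 nrm_ge0.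
rewrite -(ler_pM2l Pxp) -expr2 (sqr_nrm ipP) PP.
exact: le_trans (ler_norm _) (cauchy_schwarz ipP _ _).
Qed.

(* Spingarn's partial inverse of [M] with respect to the range of [P]. *)
Definition partial_inverse (M : E -> set E) : E -> set E := fun g d =>
  exists pi rho, [/\ M pi rho, g = P pi + (rho - P rho)
                             & d = P rho + (pi - P pi)].

(** Cross terms vanish by orthogonality, and exchanging the complementary components only swaps the
    arguments of a symmetric term. Monotonicity and maximality transfer through this identity. *)
Lemma ip_partial_inverse x y :
  ip (P x + (y - P y)) (P y + (x - P x)) = ip x y.
Proof.
rewrite !(ipE ipP) !PP -!Psym (ipC ipP y x) (ipC ipP (P y) x) -Psym; ring.
Qed.

Lemma partial_inverse_monotone M :
  ip_monotone ip M -> ip_monotone ip (partial_inverse M).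
Proof.
move=> Mmono _ _ _ _ [x [y [Mxy -> ->]]] [x' [y' [Mxy' -> ->]]].
have := Mmono _ _ _ _ Mxy Mxy'; rewrite -ip_partial_inverse !(PD, PN).
set lhs := ip _ _; set rhs := ip _ _.
suff -> : lhs = rhs by [].
by congr ip; lmod_ring ipP.
Qed.

Lemma partial_inverse_maximal M :
  ip_maximal ip M -> ip_maximal ip (partial_inverse M).
Proof.
move=> Mmax g d gd.
(* Exchanging complementary components is an involution; applied to [(g, d)] it yields the candidate
   pair for [M]. *)
exists (P g + (d - P d)), (P d + (g - P g)); split; last 2 first.
- by rewrite !(PD, PN, Pid); lmod_ring ipP.
- by rewrite !(PD, PN, Pid); lmod_ring ipP.
apply: Mmax => x y Mxy.
rewrite -ip_partial_inverse !(PD, PN, Pid).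
have := gd (P x + (y - P y)) (P y + (x - P x)) _.
set lhs := ip _ _; set rhs := ip _ _.
suff -> : lhs = rhs by apply; exists x, y.
by congr ip; lmod_ring ipP.
Qed.

(** If [d = 0], both its orthogonal components vanish: [P rho = 0] and [pi = P pi], so
    [z = pi + rho] is the splitting of [z] along [P]. *)
Lemma partial_inverse_zero M z : partial_inverse M z 0 <-> M (P z) (z - P z).
Proof.
split=> [[x [y [Mxy zE /esym zE0]]]|Mz]; last first.
  exists (P z), (z - P z); split=> //; rewrite !(PD, PN, Pid); lmod_ring ipP.
have Py : P y = 0.
  by have := congr1 P zE0; rewrite !(PD, PN, Pid) P0 subrr addr0.
have Px : P x = x.
  by apply/esym/subr0_eq; move: zE0; rewrite Py add0r.
have zxy : z = x + y by rewrite zE Px Py subr0.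
by rewrite zxy PD Px Py addr0 addrC addKr.
Qed.

(** Here [pi n] is the exact resolvent value of [M] at [xi n], and [er n] the error made in
    computing it. *)
Theorem partial_inverse_method (M : E -> set E)
    (Mmono : ip_monotone ip M) (Mmax : ip_maximal ip M)
    (lam : nat -> R) (xi pi er : nat -> E) (S : R) :
  (exists z, M (P z) (z - P z)) ->
  (forall n, 0 < lam n < 2) ->
  (forall K : R, exists n, K < \sum_(0 <= k < n) (lam k * (2 - lam k))) ->
  (forall n, \sum_(0 <= k < n) (lam k * nrm (er k)) <= S) ->
  (forall n, M (pi n) (xi n - pi n)) ->
  (forall n, xi n.+1 = xi n - lam n *: (P (xi n - (pi n + er n))
                         + (pi n + er n - P (pi n + er n)))) ->
  (fun n => nrm (P (xi n - pi n) + (pi n - P (pi n)))) @ \oo --> (0 : R) /\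
  exists z, M (P z) (z - P z) /\
    forall h, (fun n => ip (xi n) h) @ \oo --> ip z h.
Proof.
move=> [z Mz] hlam hsum1 hsum2 hM hstep.
have mono := partial_inverse_monotone _ Mmono.
have max := partial_inverse_maximal _ Mmax.
pose g n := P (pi n) + (xi n - pi n - P (xi n - pi n)).
pose d n := P (xi n - pi n) + (pi n - P (pi n)).
(* The error enters reflected across the range of [P], which keeps its norm. *)
pose e n := P (er n) - (er n - P (er n)).
have nrme n : nrm (e n) = nrm (er n).
  congr Num.sqrt; rewrite /e !(ipE ipP) !PP (ipC ipP (er n) (P (er n))); ring.
have hN n : partial_inverse M (g n) (d n) by exists (pi n), (xi n - pi n).
have hxi n : xi n = g n + d n by rewrite /g /d; lmod_ring ipP.
have hst n : xi n.+1 = xi n + lam n *: (e n - d n).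
  rewrite hstep /e /d !(PD, PN); lmod_ring ipP.
have hs2 n : \sum_(0 <= k < n) (lam k * nrm (e k)) <= S.
  by under eq_bigr do rewrite nrme.
have zP : partial_inverse M z 0 by apply/partial_inverse_zero.
split.
  exact: (prox_residual_cvg ipP _ mono lam xi g d e hlam hsum1 S hs2 hN hxi
           hst z zP).
have [z' [/partial_inverse_zero Mz' z'P]] :=
  prox_weak_cvg ipP ipc _ mono max lam xi g d e hlam hsum1 S hs2 hN hxi hst
    (ex_intro _ z zP).
by exists z'.
Qed.

End PartialInverse.



(** * Translation of the hypotheses on series, norms and completeness *)

Section RealSeries.
Context {R : realType} (f : nat -> R) (f_ge0 : forall n, 0 <= f n).

Lemma nneseries_pinfty_unbounded :
  (\sum_(0 <= n <oo) (f n)%:E = +oo)%E ->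
  forall K, exists n, K < \sum_(0 <= k < n) f k.
Proof.
move=> foo K; apply: contrapT => /forallNP fK.
suff : (\sum_(0 <= n <oo) (f n)%:E <= K%:E)%E by rewrite foo leye_eq.
apply: lime_le; first by apply: is_cvg_nneseries => n _ _; rewrite lee_fin.
by apply: nearW => n; rewrite sumEFin lee_fin leNgt; apply/negP.
Qed.

Lemma nneseries_lty_bounded :
  (\sum_(0 <= n <oo) (f n)%:E < +oo)%E ->
  exists S, forall n, \sum_(0 <= k < n) f k <= S.
Proof.
have ge n : ((\sum_(0 <= k < n) f k)%:E <= \sum_(0 <= n <oo) (f n)%:E)%E.
  by rewrite -sumEFin; apply: nneseries_lim_ge => k _ _; rewrite lee_fin.
move: ge; case: (\sum_(0 <= n <oo) _)%E => [S ge _| |/(_ 0%N)]//.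
by exists S => n; rewrite -lee_fin.
Qed.

End RealSeries.

Section HilbertSpace.
Context {R : realType}.

Lemma inner_product_of_ip {V : normedModType R} {ip : V -> V -> R} :
  inner_product_of ip -> inner_product ip.
Proof.
case=> sym lin sq; split=> // x; first by rewrite sq sqr_ge0.
by rewrite sq => /eqP; rewrite sqrf_eq0 normr_eq0 => /eqP.
Qed.

Lemma ip_norm_normr {V : normedModType R} {ip : V -> V -> R} :
  inner_product_of ip -> ip_norm ip = Num.norm.
Proof.
by case=> _ _ sq; apply/funext => x; rewrite /ip_norm sq sqrtr_sqr normr_id.
Qed.

Lemma inner_product_of_complete {V : completeNormedModType R}
  {ip : V -> V -> R} : inner_product_of ip -> ip_complete ip.
Proof.
move=> /ip_norm_normr ipn z; rewrite ipn => cz.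
have /cvg_ex[/= l zl] : cvgn z.
  apply: cauchy_cvg; apply: cauchy_exP => e /cz[N NP].
  by exists (z N), N => // n /= Nn; rewrite -ball_normE /=; exact: NP.
exists l; rewrite -(@normr0 _ V); apply: cvg_norm.
exact/subr_cvg0.
Qed.

End HilbertSpace.

(** * The product space and the projector onto the graph of [L] *)

Section Graph.
Context {R : realType} {H G : completeNormedModType R}.
Context {ipH : H -> H -> R} {ipG : G -> G -> R}.
Context (hipH : inner_product_of ipH) (hipG : inner_product_of ipG).

Let ipHP := inner_product_of_ip hipH.
Let ipGP := inner_product_of_ip hipG.

Definition prod_ip (z z' : H * G) : R := ipH z.1 z'.1 + ipG z.2 z'.2.

Lemma prod_ipP : inner_product (E := (H * G)%type) prod_ip.
Proof.
split=> [z z'|a x y z|z|[z1 z2]]; rewrite /prod_ip /=.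
- by rewrite (ipC ipHP) (ipC ipGP).
- rewrite !(ipE ipHP) !(ipE ipGP); ring.
- by rewrite addr_ge0 ?(ip_ge0 ipHP) ?(ip_ge0 ipGP).
- move=> /eqP; rewrite paddr_eq0 ?(ip_ge0 ipHP) ?(ip_ge0 ipGP)//.
  by move=> /andP[/eqP/(ip_eq0 ipHP)-> /eqP/(ip_eq0 ipGP)->].
Qed.

Notation nrm := (ip_norm prod_ip).

Lemma prod_ip_normE z : nrm z = Num.sqrt (`|z.1| ^+ 2 + `|z.2| ^+ 2).
Proof.
rewrite /ip_norm /prod_ip.
by case: hipH => _ _ ->; case: hipG => _ _ ->.
Qed.

Lemma normr_fst_le z : `|z.1| <= nrm z.
Proof.
rewrite prod_ip_normE -[leLHS]ger0_norm// -sqrtr_sqr.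
by rewrite ler_wsqrtr// lerDl sqr_ge0.
Qed.

Lemma normr_snd_le z : `|z.2| <= nrm z.
Proof.
rewrite prod_ip_normE -[leLHS]ger0_norm// -sqrtr_sqr.
by rewrite ler_wsqrtr// lerDr sqr_ge0.
Qed.

Lemma prod_nrm_le z : nrm z <= `|z.1| + `|z.2|.
Proof.
rewrite prod_ip_normE -(@ler_pXn2r _ 2)// ?nnegrE ?addr_ge0 ?sqrtr_ge0//.
rewrite sqr_sqrtr ?addr_ge0 ?sqr_ge0// sqrrD.
have : 0 <= `|z.1| * `|z.2| by rewrite mulr_ge0.
lra.
Qed.

Lemma prod_ip_complete : ip_complete (E := (H * G)%type) prod_ip.
Proof.
move=> z cz.
have [|l1 l1P] := inner_product_of_complete hipH (fun n => (z n).1).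
  move=> e /cz[N NP]; exists N => m n Nm Nn.
  rewrite (ip_norm_normr hipH); apply: le_lt_trans (NP m n Nm Nn).
  exact: (normr_fst_le (z m - z n)).
have [|l2 l2P] := inner_product_of_complete hipG (fun n => (z n).2).
  move=> e /cz[N NP]; exists N => m n Nm Nn.
  rewrite (ip_norm_normr hipG); apply: le_lt_trans (NP m n Nm Nn).
  exact: (normr_snd_le (z m - z n)).
exists (l1, l2).
apply: (cvgn_squeeze0 _ (fun n => `|(z n).1 - l1| + `|(z n).2 - l2|)).
  move=> n; rewrite ger0_norm ?nrm_ge0//.
  exact: prod_nrm_le (z n - (l1, l2)).
move: l1P l2P; rewrite (ip_norm_normr hipH) (ip_norm_normr hipG) => l1P l2P.
by rewrite -[0 : R]addr0; apply: cvgD.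
Qed.

Definition prod_op (A : H -> set H) (B : G -> set G) (z : H * G) :
  set (H * G) := [set z' | A z.1 z'.1 /\ B z.2 z'.2].

Lemma prod_op_monotone (A : H -> set H) (B : G -> set G) :
  monotone_op ipH A -> monotone_op ipG B ->
  ip_monotone (E := (H * G)%type) prod_ip (prod_op A B).
Proof.
move=> mA mB [g1 g2] [g1' g2'] [d1 d2] [d1' d2'] [/= A1 B1] [/= A2 B2].
by rewrite addr_ge0//; [exact: mA | exact: mB].
Qed.

Lemma prod_op_maximal (A : H -> set H) (B : G -> set G) :
  (forall x u, (forall y v, A y v -> 0 <= ipH (x - y) (u - v)) -> A x u) ->
  (forall x u, (forall y v, B y v -> 0 <= ipG (x - y) (u - v)) -> B x u) ->
  ip_maximal (E := (H * G)%type) prod_ip (prod_op A B).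
Proof.
move=> maxA maxB [g1 g2] [d1 d2] gd.
have {}gd g1' g2' d1' d2' : A g1' d1' -> B g2' d2' ->
    0 <= ipH (g1 - g1') (d1 - d1') + ipG (g2 - g2') (d2 - d2').
  by move=> A1 B1; exact: (gd (g1', g2') (d1', d2')).
(* If a pair of [A] gave a negative term, every pair of [B] would give a positive one, so [B g2 d2]
   by maximality; testing with [(g2, d2)] itself leaves only the negative term. *)
have gA : A g1 d1.
  apply: maxA => g1' d1' A1; rewrite leNgt; apply/negP => neg.
  have gB : B g2 d2.
    by apply: maxB => g2' d2' B1; have := gd _ _ _ _ A1 B1; lra.
  by have := gd _ _ _ _ A1 gB; rewrite !subrr (ip0l ipGP) addr0 leNgt neg.
split=> //=; apply: maxB => g2' d2' B1.
by have := gd _ _ _ _ gA B1; rewrite !subrr (ip0l ipHP) add0r.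
Qed.

Context (L : {linear H -> G}) (hLc : continuous L).
Context (Lt : G -> H) (hLt : adjoint_of ipH ipG L Lt).

Let ipLt x v : ipH x (Lt v) = ipG (L x) v. Proof. exact: hLt. Qed.

Lemma adjoint_linear a x y : Lt (a *: x + y) = a *: Lt x + Lt y.
Proof.
apply: (ip_inj ipHP) => h.
rewrite !(ipE ipHP) !(ipC ipHP _ h) !ipLt !(ipE ipGP); ring.
Qed.

Let LtD x y : Lt (x + y) = Lt x + Lt y.
Proof. by rewrite -{1}[x]scale1r adjoint_linear scale1r. Qed.

Let Lt0 : Lt 0 = 0. Proof. by apply: (addrI (Lt 0)); rewrite -LtD !addr0. Qed.

Let LtN x : Lt (- x) = - Lt x.
Proof.
by rewrite -scaleN1r -[_ *: _]addr0 adjoint_linear Lt0 addr0 scaleN1r.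
Qed.

(* Riesz representation for the equivalent inner product
   [<x, y> + <L x, L y>]. *)
Lemma id_adjoint_surj h : exists x, x + Lt (L x) = h.
Proof.
pose ipQ x y := ipH x y + ipG (L x) (L y).
have ipQE x y : ipQ x y = prod_ip (x, L x) (y, L y) by [].
have ipQP : inner_product ipQ.
  split=> [x y|a x y z|x|x].
  - by rewrite !ipQE (ipC prod_ipP).
  - rewrite /ipQ linearP !(ipE ipHP) !(ipE ipGP); ring.
  - by rewrite ipQE (ip_ge0 prod_ipP).
  - by rewrite ipQE => /(ip_eq0 prod_ipP)[].
have ipQn x : ip_norm ipQ x = nrm (x, L x) by [].
have ipQc : ip_complete ipQ.
  move=> z cz.
  have [|l lP] := inner_product_of_complete hipH z.
    move=> e /cz[N NP]; exists N => m n Nm Nn.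
    rewrite (ip_norm_normr hipH); apply: le_lt_trans (NP m n Nm Nn).
    exact: (normr_fst_le (z m - z n, L (z m - z n))).
  exists l; have [k k0 kP] := linear_lipschitz hLc.
  apply: (cvgn_squeeze0 _ (fun n => (1 + k) * `|z n - l|)) => [n|].
    rewrite ger0_norm ?nrm_ge0// ipQn; apply: le_trans (prod_nrm_le _) _.
    by rewrite /= mulrDl mul1r lerD2l.
  rewrite -(mulr0 (1 + k)); apply: cvgM; first exact: cvg_cst.
  by move: lP; rewrite (ip_norm_normr hipH).
have [||k|x xP] := riesz ipQP (ipH h) (ipH h h) ipQc.
- by move=> a x y; rewrite !(ipE ipHP).
- exact: ip_ge0.
- apply: le_trans (cauchy_schwarz_sq ipHP _ _) _.
  by rewrite ler_wpM2l ?(ip_ge0 ipHP)// lerDl (ip_ge0 ipGP).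
exists x; apply: (ip_inj ipHP) => k.
by rewrite -xP (ipDl ipHP) (ipC ipHP (Lt _)) ipLt (ipC ipGP (L k)).
Qed.

(** The remainder is kept in the explicit form [(- Lt v, v)] so that the dual solution can be read
    off as [v]. *)
Definition graph_projector (P : H * G -> H * G) : Prop :=
  forall z, (P z).2 = L (P z).1 /\ exists v, z - P z = (- Lt v, v).

Lemma graph_projector_exists : exists P, graph_projector P.
Proof.
suff /choice[P PG] : forall z : H * G, exists w : H * G,
  w.2 = L w.1 /\ exists v, z - w = (- Lt v, v) by exists P.
move=> [z1 z2]; have [x xP] := id_adjoint_surj (z1 + Lt z2).
exists (x, L x); split=> //; exists (z2 - L x); congr pair.
have -> : z1 = x + Lt (L x) - Lt z2 by rewrite xP addrK.
rewrite /= LtD LtN; lmod_ring ipHP.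
Qed.

Context (P : H * G -> H * G) (PG : graph_projector P).

(** Uniqueness of the orthogonal decomposition: the discrepancies satisfy [k = Lt m] and
    [L k = - m], so [ipH k k = - ipG m m]. Explicit values of [P] are later computed by exhibiting
    such a splitting. *)
Lemma graph_projector_eq x v z1 z2 :
  z1 = x - Lt v -> z2 = L x + v -> P (z1, z2) = (x, L x).
Proof.
move=> -> ->; case: (PG (x - Lt v, L x + v)) => P2 [v' []] /=.
case: (P _) P2 => [p1 p2] /= -> e1 e2.
pose k := x - p1; pose m := v - v'.
have k1 : k = Lt m.
  rewrite /k /m LtD LtN; apply/eqP; rewrite -subr_eq0; apply/eqP.
  by move: e1 => /eqP; rewrite -subr_eq0 => /eqP <-; lmod_ring ipHP.
have k2 : L k = - m.
  rewrite /k /m linearB; apply/eqP; rewrite -subr_eq0; apply/eqP.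
  by move: e2 => /eqP; rewrite -subr_eq0 => /eqP <-; lmod_ring ipGP.
have : ipH k k + ipG m m = 0.
  by rewrite {2}k1 ipLt k2 (ipNl ipGP) addNr.
move=> /eqP; rewrite paddr_eq0 ?(ip_ge0 ipHP) ?(ip_ge0 ipGP)//.
by move=> /andP[/eqP/(ip_eq0 ipHP)/subr0_eq-> _].
Qed.

Lemma graph_projector_orth z z' : prod_ip (P z) (z' - P z') = 0.
Proof.
case: (PG z) => Pz _; case: (PG z') => _ [v ->].
by rewrite /prod_ip /= (ipNr ipHP) ipLt Pz addNr.
Qed.

Lemma graph_projector_sym z z' : prod_ip (P z) z' = prod_ip z (P z').
Proof.
have h t t' : prod_ip (P t) t' = prod_ip (P t) (P t').
  apply/eqP; rewrite -subr_eq0 -(ipNr prod_ipP) -(ipDr prod_ipP).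
  by rewrite graph_projector_orth.
by rewrite h (ipC prod_ipP z) [RHS]h (ipC prod_ipP).
Qed.

Lemma graph_projector_id z : P (P z) = P z.
Proof.
case: (PG z) => Pz _; rewrite {1}[P z]surjective_pairing.
rewrite (graph_projector_eq (P z).1 0) ?Lt0 ?subr0 ?addr0//.
by rewrite -Pz -surjective_pairing.
Qed.

Lemma graph_projector_linear a z z' : P (a *: z + z') = a *: P z + P z'.
Proof.
case: (PG z) => Pz [v vP]; case: (PG z') => Pz' [v' vP'].
rewrite [LHS](_ : _ = ((a *: P z + P z').1, L (a *: P z + P z').1)); last first.
  rewrite [a *: z + z']surjective_pairing.
  apply: (@graph_projector_eq _ (a *: v + v')).
    have /(congr1 fst)/= := vP; have /(congr1 fst)/= := vP'.
    rewrite adjoint_linear => /(canRL (subrK _)) -> /(canRL (subrK _)) ->.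
    lmod_ring ipHP.
  have /(congr1 snd)/= := vP; have /(congr1 snd)/= := vP'.
  rewrite linearP -Pz -Pz' => /(canRL (subrK _)) -> /(canRL (subrK _)) ->.
  lmod_ring ipGP.
by rewrite [RHS]surjective_pairing /= linearP -Pz -Pz'.
Qed.

End Graph.
Arguments prod_ip {R H G} ipH ipG z z'.


(** * The primal-dual algorithm as an instance of the partial inverse method *)

Theorem theorem4p1 (R : realType)
  (H G : completeNormedModType R)
  (ipH : H -> H -> R) (ipG : G -> G -> R)
  (hipH : inner_product_of ipH) (hipG : inner_product_of ipG)
  (A : H -> set H) (B : G -> set G)
  (hA : maximally_monotone ipH A) (hB : maximally_monotone ipG B)
  (L : {linear H -> G}) (hLc : continuous L)
  (Lt : G -> H) (hLt : adjoint_of ipH ipG L Lt)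
  (hzer : zer (op_add A (fun x => Lt @` B (L x))) !=set0)
  (lam : nat -> R) (a : nat -> H) (b : nat -> G)
  (hlam : forall n, 0 < lam n < 2)
  (hsum1 : (\sum_(0 <= n <oo) ((lam n * (2 - lam n))%:E) = +oo)%E)
  (hsum2 : (\sum_(0 <= n <oo)
              ((lam n * Num.sqrt (`|a n| ^+ 2 + `|b n| ^+ 2))%:E) < +oo)%E)
  (x u p r tt ww c : nat -> H) (y v q s t w : nat -> G)
  (hy0 : y 0%N = L (x 0%N)) (hu0 : u 0%N = - Lt (v 0%N))
  (hp : forall n, resolvent A (x n + u n) (p n - a n))
  (hq : forall n, resolvent B (y n + v n) (q n - b n))
  (hr : forall n, r n = x n + u n - p n)
  (hs : forall n, s n = y n + v n - q n)
  (ht : forall n, map_inv (fun z : G => z + L (Lt z)) (L (r n) - s n) (t n))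
  (hw : forall n, map_inv (fun z : G => z + L (Lt z)) (L (p n) - q n) (w n))
  (hx : forall n, x n.+1 = x n + lam n *: (Lt (t n) - r n))
  (hyS : forall n, y n.+1 = y n - lam n *: (t n + s n))
  (huS : forall n, u n.+1 = u n - lam n *: Lt (w n))
  (hv : forall n, v n.+1 = v n + lam n *: w n)
  (htt : forall n, map_inv (fun z : H => z + Lt (L z)) (r n + Lt (s n)) (tt n))
  (hww : forall n, map_inv (fun z : H => z + Lt (L z)) (p n + Lt (q n)) (ww n))
  (hc : forall n, map_inv (fun z : H => z + Lt (L z)) (a n + Lt (b n)) (c n)) :
  [/\ (fun n => x n - ww n + c n) @ \oo --> (0 : H),
      (fun n => y n - L (ww n) + L (c n)) @ \oo --> (0 : G),
      (fun n => u n - r n + tt n - a n + c n) @ \oo --> (0 : H),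
      (fun n => v n - s n + L (tt n) - b n + L (c n)) @ \oo --> (0 : G) &
      exists (xbar : H) (vbar : G),
        [/\ zer (op_add A (fun x => Lt @` B (L x))) xbar,
            zer (op_add (fun v => [set - L z | z in op_inv A (- Lt v)])
                        (op_inv B)) vbar,
            A xbar (- Lt vbar) /\ B (L xbar) vbar,
            weak_cvg ipH x xbar & weak_cvg ipG v vbar]].
Proof.
have ipHP := inner_product_of_ip hipH; have ipGP := inner_product_of_ip hipG.
have [P PG] := graph_projector_exists hipH hipG L hLc Lt hLt.
have Peq := graph_projector_eq hipH hipG L Lt hLt P PG.
have Plin := graph_projector_linear hipH hipG L Lt hLt P PG.
have Pid := graph_projector_id hipH hipG L Lt hLt P PG.
have Ltlin := adjoint_linear hipH hipG L Lt hLt.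
have Lt0 : Lt 0 = 0.
  by have := Ltlin (-1) 0 0; rewrite scaler0 addr0 scaleN1r addNr.
have LtN z : Lt (- z) = - Lt z.
  by rewrite -scaleN1r -[_ *: z]addr0 Ltlin Lt0 addr0 scaleN1r.
have LtD z z' : Lt (z + z') = Lt z + Lt z'.
  by rewrite -{1}[z]scale1r Ltlin scale1r.
have LD z z' : L (z + z') = L z + L z' by exact: linearD.
have LN z : L (- z) = - L z by exact: linearN.
have LZ k z : L (k *: z) = k *: L z by exact: linearZ.
pose ip2 := prod_ip ipH ipG.
have Psym z1 z2 : ip2 (P z1) z2 = ip2 z1 (P z2).
  exact: graph_projector_sym hipH hipG L Lt hLt P PG z1 z2.
have ipP : inner_product ip2 := prod_ipP hipH hipG.
have ipc : ip_complete ip2 := prod_ip_complete hipH hipG.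
have Mmono := prod_op_monotone A B hA.1 hB.1.
have Mmax := prod_op_maximal hipH hipG A B hA.2 hB.2.
set M := prod_op A B in Mmono Mmax.
pose xi n : H * G := (x n + u n, y n + v n).
pose pi n : H * G := (p n - a n, q n - b n).
pose er n : H * G := (a n, b n).
have tE n : t n + L (Lt (t n)) = L (r n) - s n := ht n.
have wE n : w n + L (Lt (w n)) = L (p n) - q n := hw n.
have ttE n : tt n + Lt (L (tt n)) = r n + Lt (s n) := htt n.
have wwE n : ww n + Lt (L (ww n)) = p n + Lt (q n) := hww n.
have cE n : c n + Lt (L (c n)) = a n + Lt (b n) := hc n.
have sE n : s n = L (r n) - (t n + L (Lt (t n))) by rewrite tE subKr.
have qE n : q n = L (p n) - (w n + L (Lt (w n))) by rewrite wE subKr.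
have rE n : r n = tt n + Lt (L (tt n)) - Lt (s n) by rewrite ttE addrK.
have pE n : p n = ww n + Lt (L (ww n)) - Lt (q n) by rewrite wwE addrK.
have aE n : a n = c n + Lt (L (c n)) - Lt (b n) by rewrite cE addrK.
(* The graph is preserved because [t n + s n = L (r n - Lt (t n))], its complement because [u] moves
   by [- Lt] of the increment of [v]. *)
have inv n : y n = L (x n) /\ u n = - Lt (v n).
  elim: n => [//|n [IHy IHu]]; split.
    rewrite hyS hx sE !(LD, LZ, LN) IHy; lmod_ring ipGP.
  rewrite huS hv [v n + _]addrC Ltlin IHu; lmod_ring ipHP.
have Pxi n : P (xi n) = (x n, y n).
  have [yE uE] := inv n; rewrite yE; apply: (Peq _ (v n)).
    by rewrite uE.
  by rewrite yE.
(* Written with [R], the projections of [(r n, s n)] and [(p n, q n)] reproduce the update rules. *)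
have Prs n : P (r n, s n) = (r n - Lt (t n), s n + t n).
  have st : s n + t n = L (r n - Lt (t n)).
    by rewrite sE !(LD, LN); lmod_ring ipGP.
  rewrite st; apply: (Peq _ (- t n)).
    by rewrite LtN opprK subrK.
  by rewrite -st addrK.
have Ppq n : P (p n, q n) = (p n - Lt (w n), q n + w n).
  have st : q n + w n = L (p n - Lt (w n)).
    by rewrite qE !(LD, LN); lmod_ring ipGP.
  rewrite st; apply: (Peq _ (- w n)).
    by rewrite LtN opprK subrK.
  by rewrite -st addrK.
(* Written with [Q], the projections of the exact residual [xi n - pi n] and of [pi n] bring in
   [tt], [ww] and [c]. *)
have Pra n : P (r n + a n, s n + b n) = (tt n + c n, L (tt n + c n)).
  apply: (Peq _ (s n + b n - L (tt n + c n))); last by lmod_ring ipGP.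
  by rewrite rE aE !(LD, LN, LtD, LtN); lmod_ring ipHP.
have Ppi n : P (pi n) = (ww n - c n, L (ww n - c n)).
  apply: (Peq _ (q n - b n - L (ww n - c n))); last by lmod_ring ipGP.
  by rewrite /= pE aE !(LD, LN, LtD, LtN); lmod_ring ipHP.
have xipi n : xi n - pi n = (r n + a n, s n + b n).
  by congr pair; rewrite /= ?hr ?hs; [lmod_ring ipHP | lmod_ring ipGP].
have [S SP] : exists S, forall n,
    \sum_(0 <= k < n) (lam k * ip_norm ip2 (er k)) <= S.
  have [|S SP] := nneseries_lty_bounded _ _ hsum2.
    by move=> n; rewrite mulr_ge0 ?sqrtr_ge0//; have /andP[/ltW] := hlam n.
  exists S => n; under eq_bigr do rewrite (prod_ip_normE hipH hipG).
  exact: SP.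
have K1 K : exists n, K < \sum_(0 <= k < n) (lam k * (2 - lam k)).
  apply: (nneseries_pinfty_unbounded _ _ hsum1) => n.
  by have /andP[? ?] := hlam n; rewrite mulr_ge0//; lra.
(* A primal solution [x0] comes with [v0] in [B (L x0)] such that [- Lt v0] is in [A x0]; the
   witness has projection [(x0, L x0)] and remainder [(- Lt v0, v0)]. *)
have Mzer : exists z, M (P z) (z - P z).
  case: hzer => x0 [a0 [b0 [Aa0 [v0 Bv0 <-] e0]]].
  exists (x0 - Lt v0, L x0 + v0); rewrite (Peq x0 v0) //.
  have a0E : a0 = - Lt v0 by apply/eqP; rewrite -addr_eq0 -e0.
  by split; rewrite /= addrAC subrr add0r -?a0E.
have Mpi n : M (pi n) (xi n - pi n).
  have [_ [a' [-> Aa' eA]]] := hp n; have [_ [b' [-> Bb' eB]]] := hq n.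
  by split; rewrite /= ?eA ?eB addrAC subrr add0r.
have step n : xi n.+1 = xi n - lam n *: (P (xi n - (pi n + er n))
    + (pi n + er n - P (pi n + er n))).
  have -> : pi n + er n = (p n, q n) by congr pair; rewrite /= subrK.
  have -> : xi n - (p n, q n) = (r n, s n) by congr pair; rewrite /= ?hr ?hs.
  rewrite Prs Ppq; congr pair; rewrite /= ?hx ?huS ?hyS ?hv.
    lmod_ring ipHP.
  lmod_ring ipGP.
have [D0 [z [Mz zP]]] := partial_inverse_method ipP ipc P Plin Pid Psym M Mmono
  Mmax lam xi pi er S Mzer hlam K1 SP Mpi step.
(* The components of [P (D n)] are the sequences of (i), those of [D n - P (D n)] the sequences of
   (ii). *)
pose D n := P (xi n - pi n) + (pi n - P (pi n)).
have PB z1 z2 : P (z1 - z2) = P z1 - P z2.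
  by rewrite addrC -scaleN1r Plin scaleN1r addrC.
have PD n : P (D n) = P (xi n) - P (pi n).
  by rewrite /D -[P (_ - _)]scale1r Plin !PB !Pid; lmod_ring ipP.
have Dpi n : D n - P (D n) = pi n - P (pi n).
  by rewrite PD /D PB; lmod_ring ipP.
have nrmP := nrm_projector_le ipP P Pid Psym.
have PDcvg : (fun n => ip_norm ip2 (P (D n))) @ \oo --> (0 : R).
  apply: (cvgn_squeeze0 _ _ _ D0) => n.
  by rewrite ger0_norm ?nrm_ge0//; exact: nrmP.
have QDcvg : (fun n => ip_norm ip2 (D n - P (D n))) @ \oo --> (0 : R).
  apply: (cvgn_squeeze0 _ (fun n => ip_norm ip2 (D n) + ip_norm ip2 (P (D n)))).
    by move=> n; rewrite ger0_norm ?nrm_ge0//; exact: nrmB ipP _ _.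
  by rewrite -[0 : R]addr0; apply: cvgD.
have PDE n : P (D n) = (x n - ww n + c n, y n - L (ww n) + L (c n)).
  rewrite PD Pxi Ppi LD LN.
  by congr pair; rewrite /= opprB addrA addrAC.
have QDE n : D n - P (D n) =
    (u n - r n + tt n - a n + c n, v n - s n + L (tt n) - b n + L (c n)).
  rewrite Dpi; have -> : pi n = xi n - (xi n - pi n) by rewrite subKr.
  rewrite PB Pxi xipi Pra LD.
  by congr pair; [lmod_ring ipHP | lmod_ring ipGP].
have [Pz2 [vbar zPz]] := PG z.
have [zA zB] : A (P z).1 (- Lt vbar) /\ B (L (P z).1) vbar.
  by move: Mz; rewrite zPz => -[]; rewrite Pz2.
split.
- apply: (cvgn_squeeze0 _ _ _ PDcvg) => n; rewrite PDE.
  exact: (normr_fst_le hipH hipG (_, _)).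
- apply: (cvgn_squeeze0 _ _ _ PDcvg) => n; rewrite PDE.
  exact: (normr_snd_le hipH hipG (_, _)).
- apply: (cvgn_squeeze0 _ _ _ QDcvg) => n; rewrite QDE.
  exact: (normr_fst_le hipH hipG (_, _)).
- apply: (cvgn_squeeze0 _ _ _ QDcvg) => n; rewrite QDE.
  exact: (normr_snd_le hipH hipG (_, _)).
exists (P z).1, vbar; split=> //.
- by exists (- Lt vbar), (Lt vbar); split=> //; rewrite addNr.
- exists (- L (P z).1), (L (P z).1); split=> //; last by rewrite addNr.
  by exists (P z).1.
(* By symmetry of [P], pairing [xi n] with [P (h, 0)] returns [ipH (x n) h]; pairing with the
   complementary part of [(0, h)] then isolates [v n]. *)
- move=> h; have zh z1 : ip2 (P z1) (h, 0) = ipH (P z1).1 h.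
    by rewrite /ip2 /prod_ip /= (ip0r ipGP) addr0.
  have -> : (fun n => ipH (x n) h) = (fun n => ip2 (xi n) (P (h, 0))).
    by apply/funext => n; rewrite -Psym zh Pxi.
  by rewrite -zh Psym; exact: zP.
- move=> h; have -> : ipG vbar h = ip2 z ((0, h) - P (0, h)).
    rewrite (ipDr ipP) (ipNr ipP) -Psym -(ipNl ipP) -(ipDl ipP) zPz.
    by rewrite /ip2 /prod_ip /= (ip0r ipHP) add0r.
  have -> : (fun n => ipG (v n) h) = (fun n => ip2 (xi n) ((0, h) - P (0, h))).
    apply/funext => n.
    rewrite (ipDr ipP) (ipNr ipP) -Psym -(ipNl ipP) -(ipDl ipP) Pxi.
    by rewrite /ip2 /prod_ip /= (ip0r ipHP) add0r addrAC subrr add0r.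
  exact: zP.
Qed.
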